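(* Let $R$ be a ring. Then the following statements are equivalent: (1) No proper left ideal of $R$ is nil-essential. (2) No maximal left ideal of $R$ is nil-essential. (3) $R$ is a semisimple ring.
   Context: Rings are associative with identity, not necessarily commutative. A left ideal $I$ of $R$ is nil-essential if, for every left ideal $\mu$ of $R$, $I\cap\mu=0$ implies that $\mu$ is nilpotent, i.e. $\mu^n=0$ for some $n\geq 1$. A module $M$ is semisimple if and only if every submodule of $M$ is a direct summand of $M$; the ring $R$ is semisimple if it is semisimple as a left module over itself. *)

(* Defs.v *)
From mathcomp Require Import all_boot all_algebra.
From mathcomp Require Import boolp classical_sets.

Set Implicit Arguments.
Unset Strict Implicit.
Unset Printing Implicit Defensive.

Import GRing.Theory.

Local Open Scope ring_scope.
Local Open Scope classical_set_scope.

Section Modules.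
Variables (R : pzRingType) (M : lmodType R).
Implicit Types A B : set M.

Definition submodule A : Prop := GRing.submod_closed [in A].

Definition direct_summand A : Prop :=
  exists B, [/\ submodule B, A `&` B = [set 0]
    & [set a + b | a in A & b in B] = [set: M]].

Definition semisimple_module : Prop :=
  forall A, submodule A -> direct_summand A.

End Modules.

Section Rings.
Variable R : pzRingType.
Implicit Types I J mu : set R.

Definition left_ideal I : Prop := @submodule R R^o I.

Definition proper_left_ideal I : Prop := left_ideal I /\ I <> [set: R].

Definition maximal_left_ideal I : Prop :=
  proper_left_ideal I /\ forall J, proper_left_ideal J -> I `<=` J -> J = I.

(* The additive subgroup generated by the products x * y, x in I, y in J. *)
Definition ideal_mul I J : set R :=
  [set z | exists2 s : seq (R * R),
     forall p, p \in s -> I p.1 /\ J p.2 & z = \sum_(p <- s) p.1 * p.2].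

(* I * (I * (... * I)), with n factors; by convention the whole ring if n = 0. *)
Definition ideal_exp I (n : nat) : set R := iterop n ideal_mul I [set: R].

Definition nilpotent_ideal I : Prop :=
  exists2 n : nat, (1 <= n)%N & ideal_exp I n = [set 0].

Definition nil_essential I : Prop :=
  forall mu, left_ideal mu -> I `&` mu = [set 0] -> nilpotent_ideal mu.

End Rings.

Definition semisimple_ring (R : pzRingType) : Prop := semisimple_module R^o.

(* Main.v *)
Require Import Defs.
From mathcomp Require Import all_boot all_algebra.
From mathcomp Require Import boolp classical_sets.

(** A nil-essential left ideal [I] plays the part of an essential one: every
    left ideal meeting [I] trivially is negligible.

    If all maximal left ideals fail to be nil-essential, let [A] be any left
    ideal.  Zorn's lemma yields [B] maximal among the left ideals with
    [A `&` B = 0], and then [A + B] is essential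
    ([add_pseudo_complement_essential]).
    Were [A + B] proper, a second use of Zorn's lemma would put it inside a
    maximal left ideal, itself essential and a fortiori nil-essential.  So
    [A + B] is the whole ring and [A] is a direct summand.  Both appeals to
    Zorn's lemma are instances of [maximal_submodule_avoiding]: the submodules
    to be maximised avoid [A] minus [0] in one case and [1] in the other.

    If the ring is semisimple and [I] is nil-essential, then [I] has a
    complement [B], which is nilpotent.  Writing [1 = a + b] along
    this decomposition makes [b] an idempotent of [B]; an idempotent of a
    nilpotent ideal is zero ([nilpotent_idempotent_eq0]), hence [1] is in [I]
    and [I] is not proper. *)

Set Implicit Arguments.
Unset Strict Implicit.
Unset Printing Implicit Defensive.

Import GRing.Theory.

Local Open Scope ring_scope.
Local Open Scope classical_set_scope.

Section Submodules.
Variables (R : pzRingType) (M : lmodType R).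
Implicit Types A B C S X : set M.

Lemma submoduleP A :
  submodule A <-> A 0 /\ forall a u v, A u -> A v -> A (a *: u + v).
Proof.
split=> [[A0 Al]|[A0 Al]]; split=> [|a u v Au Av].
- by rewrite in_setE in A0.
- by have := Al a u v (mem_set Au) (mem_set Av); rewrite in_setE.
- exact: mem_set.
- by rewrite !in_setE in Au Av *; exact: Al.
Qed.

Lemma submodule0 A : submodule A -> A 0.
Proof. by case/submoduleP. Qed.

Lemma submoduleZ A a u : submodule A -> A u -> A (a *: u).
Proof.
by case/submoduleP=> A0 Al Au; rewrite -[a *: u]addr0; exact: Al.
Qed.

Lemma submoduleD A u v : submodule A -> A u -> A v -> A (u + v).
Proof. by case/submoduleP=> _ Al Au Av; rewrite -[u]scale1r; exact: Al. Qed.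

Lemma submoduleB A u v : submodule A -> A u -> A v -> A (u - v).
Proof.
move=> sA Au Av; apply: submoduleD => //.
by rewrite -scaleN1r; exact: submoduleZ.
Qed.

Lemma submodule_add A B :
  submodule A -> submodule B -> submodule [set a + b | a in A & b in B].
Proof.
move=> sA sB; apply/submoduleP; split.
  by exists 0; [exact: submodule0|exists 0; [exact: submodule0|rewrite addr0]].
move=> c _ _ [a Aa [b Bb <-]] [a' Aa' [b' Bb' <-]].
exists (c *: a + a'); first by apply: submoduleD => //; exact: submoduleZ.
exists (c *: b + b'); first by apply: submoduleD => //; exact: submoduleZ.
by rewrite scalerDr addrACA.
Qed.

Lemma sub_addl A B : submodule B -> A `<=` [set a + b | a in A & b in B].
Proof.
by move=> sB a Aa; exists a => //; exists 0; [exact: submodule0|rewrite addr0].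
Qed.

Lemma sub_addr A B : submodule A -> B `<=` [set a + b | a in A & b in B].
Proof.
by move=> sA b Bb; exists 0; [exact: submodule0|exists b => //; rewrite add0r].
Qed.

(** Avoiding [X] is a condition of finite character, so it passes to unions of
    chains and Zorn's lemma applies. *)
Lemma maximal_submodule_avoiding S X :
  submodule S -> S `&` X = set0 ->
  exists B, [/\ submodule B, S `<=` B, B `&` X = set0
    & forall C, submodule C -> B `<=` C -> C `&` X = set0 -> C = B].
Proof.
move=> sS SX.
(* The union of the empty chain is empty, hence not a submodule: maximising
   over all [A] with [S `|` A] admissible makes it stand for [S] itself. *)
pose P A := submodule (S `|` A) /\ (S `|` A) `&` X = set0.
have [F FP Ftot|A [[sSA SAX] maxA]] := @Zorn_bigcup M P.
  have cover u v : (S `|` \bigcup_(A in F) A) u -> (S `|` \bigcup_(A in F) A) v ->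
      (S u /\ S v) \/ exists2 A, F A & (S `|` A) u /\ (S `|` A) v.
    move=> [Su|[A FA Au]] [Sv|[A' FA' Av]].
    - by left.
    - by right; exists A' => //; split; [left|right].
    - by right; exists A => //; split; [right|left].
    - right; case: (Ftot A A' FA FA') => sub.
      + by exists A' => //; split; right => //; exact: sub.
      + by exists A => //; split; right => //; exact: sub.
  split.
    apply/submoduleP; split; first by left; exact: submodule0.
    move=> a u v Uu Uv; have [[Su Sv]|[A FA [Au Av]]] := cover u v Uu Uv.
      by left; apply: submoduleD => //; exact: submoduleZ.
    have [sSA _] := FP A FA.
    have [Sw|Aw] : (S `|` A) (a *: u + v).
      by apply: submoduleD => //; exact: submoduleZ.
    + by left.
    + by right; exists A.
  rewrite -subset0 => x [[Sx|[A FA Ax]] Xx]; first by rewrite -SX.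
  by have [_ <-] := FP A FA; split => //; right.
exists (S `|` A); split=> // C sC SAC CX.
have SC : S `|` C = C by apply/setUidPr => x Sx; apply: SAC; left.
apply/seteqP; split=> // x Cx; right; apply: contrapT => nAx.
apply: (maxA C); last by rewrite /P SC.
by split=> [y Ay|CA]; [apply: SAC; right|exact/nAx/CA].
Qed.

Lemma setI_eq0P A B : submodule A -> submodule B ->
  A `&` B = [set 0] <-> forall x, A x -> B x -> x = 0.
Proof.
move=> sA sB; split=> [AB0 x Ax Bx|AB0].
  by have : (A `&` B) x by []; rewrite AB0.
apply/seteqP; split=> [x [Ax Bx]|_ ->]; first exact: AB0.
by split; exact: submodule0.
Qed.

(** [A `&` C = 0] says that [C] avoids [A] minus [0], which is what makes Zorn's
    lemma available here. *)
Lemma exists_pseudo_complement A : submodule A ->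
  exists B, [/\ submodule B, A `&` B = [set 0]
    & forall C, submodule C -> B `<=` C -> A `&` C = [set 0] -> C = B].
Proof.
move=> sA.
have s0 : submodule [set (0 : M)].
  by apply/submoduleP; split=> // a _ _ -> ->; rewrite scaler0 addr0.
have avoidP C : submodule C ->
    C `&` (A `\ 0) = set0 <-> A `&` C = [set 0].
  move=> sC; rewrite setI_eq0P //; split=> [C0 x Ax Cx|C0].
    apply: contrapT => x0.
    by have : (C `&` (A `\ 0)) x by []; rewrite C0.
  by rewrite -subset0 => x [Cx [Ax]]; apply; exact: C0.
have [||B [sB _ /(avoidP _ sB) AB maxB]] :=
  @maximal_submodule_avoiding [set 0] (A `\ 0).
- by [].
- by rewrite -subset0 => x [-> [_]]; apply.
by exists B; split=> // C sC BC /(avoidP _ sC); exact: maxB.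
Qed.

(** If [U] meets [A + B] trivially, then [A] still meets [B + U] trivially, so
    maximality of [B] forces [U] inside [B]. *)
Lemma add_pseudo_complement_essential A B U :
  submodule A -> submodule B -> A `&` B = [set 0] ->
  (forall C, submodule C -> B `<=` C -> A `&` C = [set 0] -> C = B) ->
  submodule U -> [set a + b | a in A & b in B] `&` U = [set 0] -> U = [set 0].
Proof.
move=> sA sB /setI_eq0P AB maxB sU /setI_eq0P ABU.
have sAB := submodule_add sA sB; have sBU := submodule_add sB sU.
have BU : [set b + u | b in B & u in U] = B.
  apply: maxB => //; first exact: sub_addl.
  apply/setI_eq0P => // x Aa [b Bb [u Uu E]]; subst x.
  suff u0 : u = 0 by rewrite u0 addr0 in Aa *; exact: AB.
  apply: ABU => //; exists (b + u) => //; exists (- b).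
    by rewrite -sub0r; apply: submoduleB => //; exact: submodule0.
  by rewrite addrAC subrr add0r.
apply/seteqP; split=> [u Uu|_ ->]; last exact: submodule0.
by apply: ABU => //; apply: sub_addr => //; rewrite -BU; exact: sub_addr.
Qed.

End Submodules.

Section LeftIdeals.
Variable R : pzRingType.
Implicit Types I J S : set R.

Lemma left_ideal_full I : left_ideal I -> I 1 -> I = [set: R].
Proof.
move=> sI I1; apply/seteqP; split=> // x _; rewrite -[x]mulr1.
exact: (submoduleZ (M := R^o)).
Qed.

(** A left ideal is proper exactly when it avoids [1]. *)
Lemma exists_maximal_left_ideal S : proper_left_ideal S ->
  exists2 I, maximal_left_ideal I & S `<=` I.
Proof.
have avoid1 I : left_ideal I -> I `&` [set 1] = set0 <-> I <> [set: R].
  move=> sI; split=> [I1 IT|nIT].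
    have : (I `&` [set 1]) 1 by rewrite IT; split.
    by rewrite I1.
  by rewrite -subset0 => x [+ x1]; rewrite x1 => /(left_ideal_full sI).
move=> [sS /(avoid1 _ sS) S1].
have [I [sI SI /(avoid1 _ sI) nI maxI]] :=
  @maximal_submodule_avoiding R R^o S [set 1] sS S1.
exists I => //; split=> // J [sJ /(avoid1 _ sJ) nJ] IJ; exact: maxI.
Qed.

Lemma nilpotent_ideal0 : nilpotent_ideal [set (0 : R)].
Proof. by exists 1. Qed.

(** An idempotent of [I] is a product of [n] copies of itself, hence in [I ^ n]. *)
Lemma nilpotent_idempotent_eq0 I e :
  nilpotent_ideal I -> I e -> e * e = e -> e = 0.
Proof.
move=> [n n1 In] Ie ee; suff : ideal_exp I n e by rewrite In.
case: n n1 {In} => // n _; rewrite /ideal_exp.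
elim: n => //= n IHn; exists [:: (e, e)]; last by rewrite big_seq1 ee.
by move=> p /[!inE] /eqP ->.
Qed.

Lemma semisimple_of_maximal_not_nil_essential :
  (forall I, maximal_left_ideal I -> ~ nil_essential I) -> semisimple_ring R.
Proof.
move=> maxR A sA.
have [B [sB AB maxB]] := exists_pseudo_complement sA.
exists B; split=> //; set S := (X in X = _); apply: contrapT => nS.
have sS : left_ideal S by exact: submodule_add.
have [I Imax SI] := exists_maximal_left_ideal (conj sS nS).
case: (maxR I Imax) => U sU IU; rewrite (_ : U = [set 0]).
  exact: nilpotent_ideal0.
have [[sI _] _] := Imax.
apply: (add_pseudo_complement_essential sA sB AB maxB sU).
apply/setI_eq0P => // x Sx Ux.
by move/(setI_eq0P sI sU): IU; apply=> //; exact: SI.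
Qed.

Lemma semisimple_proper_not_nil_essential I :
  semisimple_ring R -> proper_left_ideal I -> ~ nil_essential I.
Proof.
move=> ssR [sI nI] essI; apply: nI; apply: left_ideal_full => //.
have [B [sB IB IBT]] := ssR I sI.
have Bnil := essI B sB IB.
have [a Ia [b Bb ab1]] : [set a + b | a in I & b in B] (1 : R^o).
  by rewrite IBT.
suff b0 : b = 0 by rewrite -ab1 b0 addr0.
apply: (nilpotent_idempotent_eq0 Bnil Bb).
(* The left side lies in [I], the right side in [B], so both vanish. *)
have ba : b * a = b - b * b.
  by rewrite -[X in X - _]mulr1 -ab1 mulrDr addrK.
apply/eqP; rewrite eq_sym -subr_eq0 -ba; apply/eqP.
apply: (proj1 (setI_eq0P sI sB) IB).
  exact: (submoduleZ (M := R^o)).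
rewrite ba; apply: (submoduleB (M := R^o)) => //.
exact: (submoduleZ (M := R^o)).
Qed.

End LeftIdeals.

Theorem corollary9 (R : pzRingType) :
  [<-> (forall I : set R, proper_left_ideal I -> ~ nil_essential I);
       (forall I : set R, maximal_left_ideal I -> ~ nil_essential I);
       semisimple_ring R].
Proof.
tfae.
- by move=> properR I [Iproper _]; exact: properR.
- exact: semisimple_of_maximal_not_nil_essential.
- by move=> ssR I; exact: semisimple_proper_not_nil_essential.
Qed.
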